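(* For $k\ge0$ write $3^k=\sum_{i\ge0}\omega_i(k)2^i$ with $\omega_i(k)\in\{0,1\}$ (the binary expansion), and let $A_k=\{i\ge0:\omega_i(k)=1\}$. Let \[ W=\{k\in\mathbb{N}: A_k \text{ contains no 3-term arithmetic progression}\}. \] Then for every $\varepsilon>0$, $\#(W\cap[1,N])=O_\varepsilon(N^{\varepsilon})$.
   Context: A 3-term arithmetic progression in a set $A$ of integers means $a,a+d,a+2d\in A$ with $d\ge1$. *)

(* Defs.v *)
From Stdlib Require Import Reals Arith List.

Definition omega (i k : nat) : bool := Nat.testbit (3 ^ k) i.

Definition A (k : nat) (i : nat) : Prop := omega i k = true.

Definition has_3AP (S : nat -> Prop) : Prop :=
  exists a d : nat, 1 <= d /\ S a /\ S (a + d) /\ S (a + 2 * d).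

Definition W (k : nat) : Prop := ~ has_3AP (A k).

(* Main.v *)
(** The residue of 3^k modulo 2^(m+2) has period 2^m in k and takes distinct
    values over one period, so for k < 2^m the first m + 2 binary digits of 3^k
    determine k. If k is in W these digits form a subset of [0, m + 2) without
    3-term progressions, which by Roth's theorem has at most (m + 2) / p elements
    once m is large, for any fixed p. There are only 2^(o(m)) such sets, while
    N is about 2^m.

    Roth's theorem is obtained from Szemeredi's combinatorial proof, arranged as
    a density decrement. If A has no 3-term progression and is nearly as dense as
    possible, then it contains, in its second quarter, a cube
    m + {0, e_1} + ... + {0, e_d} with bounded e_i. Reflecting the first quarter of
    A in the points of the cube gives sets disjoint from A, which grow with the
    dimension; hence one of them, T, is almost invariant under translation by
    some 2 e_i. The complement of T then splits into few progressions of
    difference 2 e_i, on each of which A has at most the extremal density. As T is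
    a positive proportion of the interval, A is too sparse, a contradiction. *)

Require Import Defs.
From Stdlib Require Import Reals Arith List Lia Lra.
From mathcomp Require all_boot zify.

Module APFree.
Import all_boot zify.
Local Set Implicit Arguments.
Local Unset Strict Implicit.
Implicit Types A B C T : pred nat.

(** * Roth's theorem *)

Definition apfree (A : pred nat) :=
  forall a d, 0 < d -> ~~ [&& A a, A (a + d) & A (a + 2 * d)].

Definition cnt (A : pred nat) n := \sum_(i < n) A i.

Lemma cntS A n : cnt A n.+1 = cnt A n + A n.
Proof. by rewrite /cnt big_ord_recr. Qed.

Lemma cntD A m n : cnt A (m + n) = cnt A m + cnt (fun i => A (m + i)) n.
Proof. by rewrite /cnt big_split_ord. Qed.

Lemma eq_cnt A B n : (forall i, i < n -> A i = B i) -> cnt A n = cnt B n.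
Proof. by move=> eqAB; apply: eq_bigr => i _; rewrite eqAB. Qed.

Lemma leq_cnt A B n : (forall i, i < n -> A i -> B i) -> cnt A n <= cnt B n.
Proof.
move=> sAB; apply: leq_sum => i _.
by case: (A i) (sAB i (ltn_ord i)) => // ->.
Qed.

Lemma cnt_leq A n : cnt A n <= n.
Proof.
by elim: n => [|n IHn]; [rewrite /cnt big_ord0 | rewrite cntS; case: (A n); lia].
Qed.

Lemma leq_cntr A m n : m <= n -> cnt A m <= cnt A n.
Proof. by move=> /subnK <-; rewrite addnC cntD leq_addr. Qed.

Lemma cntC A n : cnt A n + cnt (predC A) n = n.
Proof.
elim: n => [|n IHn]; first by rewrite /cnt !big_ord0.
by rewrite !cntS /=; case: (A n) => /=; lia.
Qed.

Lemma cnt_rev A n : cnt (fun i => A (n - i)) n.+1 = cnt A n.+1.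
Proof.
rewrite /cnt (reindex_inj rev_ord_inj) /=; apply: eq_bigr => i _.
by congr (nat_of_bool (A _)); case: i => i /=; lia.
Qed.

Lemma cnt_mod A f k : cnt A (k * f) = \sum_(r < f) cnt (fun i => A (r + i * f)) k.
Proof.
elim: k => [|k IHk].
  by rewrite /cnt big_ord0 big1 // => r _; rewrite big_ord0.
rewrite mulSn addnC cntD IHk -big_split /=; apply: eq_bigr => r _.
by rewrite cntS addnC [k * f + r]addnC addnC.
Qed.

Lemma cnt_pigeonhole B h q v : 0 < v -> v * h <= q * cnt B (v * h) ->
  exists2 b, b < v & h <= q * cnt (fun i => B (b * h + i)) h.
Proof.
elim: v => // v IHv _.
rewrite mulSn addnC cntD.
have [le_h _ | lt_h] := leqP h (q * cnt (fun i => B (v * h + i)) h).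
  by exists v.
case: v IHv lt_h => [|v] IHv lt_h.
  by rewrite mul0n /cnt big_ord0; rewrite /cnt mul0n in lt_h; lia.
move=> le_sum; case: IHv => //; first by lia.
by move=> b ltb hb; exists b => //; lia.
Qed.

(** * Counting along runs between cuts *)

Section Runs.

Variables (Q j K : nat).

(* The cuts at [t] split the window into runs, each starting right after a cut
   or at [0]; each run costs one [K]. *)
Lemma cnt_runs (a t : pred nat) n :
    (forall i, a i -> ~~ t i) ->
    (forall s l, Q * cnt (fun i => a (s + i)) l <= j * l + K) ->
  Q * cnt a n <= j * cnt (predC t) n
                 + K * cnt (fun i => ~~ t i && ((i == 0) || t i.-1)) n.
Proof.
move=> disj bnd; set st := fun i => _.
(* [s] is the start of the run still open at [n]: everything before it is paid for, and [concl]
   closes it at the price of one more [K]. *)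
pose inv n s := [/\ s <= n, (s == 0) || t s.-1, forall i, s <= i < n -> ~~ t i
  & Q * cnt a s <= j * cnt (predC t) s + K * cnt st s].
have concl m s : inv m s ->
    Q * cnt a m <= j * cnt (predC t) m + K * cnt st m.
  case=> le_sm s_start no_t bs.
  have [lt_sm|ge_sm] := ltnP s m; last by have -> : m = s by lia.
  have st_s : st s by rewrite /st s_start no_t //; lia.
  have {bs} : Q * cnt a s + (j * (m - s) + K)
     <= j * (cnt (predC t) s + (m - s)) + K * (cnt st s).+1 by lia.
  have cntst : (cnt st s).+1 <= cnt st m.
    by have := leq_cntr st lt_sm; rewrite cntS st_s addn1.
  have cntt : cnt (predC t) m = cnt (predC t) s + (m - s).
    rewrite -[in LHS](subnKC le_sm) cntD; congr addn.
    rewrite -[RHS](cntC predT (m - s)) [X in _ + X](eq_cnt (B := pred0)) //.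
    rewrite [cnt pred0 _]big1 // addn0; apply: eq_cnt => i lti /=.
    by apply: no_t; lia.
  have : cnt a m = cnt a s + cnt (fun i => a (s + i)) (m - s).
    by rewrite -cntD subnKC.
  rewrite cntt => ->; have := bnd s (m - s); nia.
have [s /concl //] : exists s, inv n s.
elim: n => [|m [s IHm]].
  by exists 0; split=> //; rewrite /cnt !big_ord0 !muln0.
case tm: (t m).
  exists m.+1; split=> //; first by move=> i; lia.
  have := concl _ _ IHm; rewrite !cntS.
  have -> : a m = false by apply: contraTF tm; apply: disj.
  by nia.
case: IHm => le_sm s_start no_t bs; exists s; split=> //; first by lia.
move=> i /andP[le_si]; rewrite ltnS leq_eqVlt => /predU1P[->|lt_im].
  by rewrite tm.
by rewrite no_t // le_si.
Qed.

(** Apply [cnt_runs] in each residue class mod [f], where runs are progressions of difference [f];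
    the initial runs of the [f] classes cost the term [K * f]. *)
Lemma cnt_runs_mod (A T : pred nat) f k :
    (forall i, A i -> ~~ T i) ->
    (forall s l, Q * cnt (fun i => A (s + i * f)) l <= j * l + K) ->
  Q * cnt A (k * f) <= j * cnt (predC T) (k * f)
    + K * (f + cnt (fun x => ~~ T x && ((f <= x) && T (x - f))) (k * f)).
Proof.
move=> disj bnd; case: k => [|k].
  by rewrite mul0n /cnt !big_ord0 muln0.
apply: (@leq_trans (j * cnt (predC T) (k.+1 * f)
    + K * cnt (fun x => ~~ T x && ((x < f) || T (x - f))) (k.+1 * f))).
  rewrite !cnt_mod !big_distrr -big_split /=; apply: leq_sum => r _.
  apply: leq_trans (cnt_runs (t := fun i => T (r + i * f)) _ _ _) _.
  - by move=> i; apply: disj.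
  - move=> s l; apply: leq_trans (bnd (r + s * f) l).
    rewrite leq_mul2l; apply/orP; right; apply: leq_cnt => i _.
    by rewrite mulnDl addnA.
  rewrite leq_add2l leq_mul2l; apply/orP; right; apply: leq_cnt => i _.
  case/andP=> -> /=; case: i => [|i] /=; first by rewrite addn0 ltn_ord.
  by rewrite mulSn addnCA addKn => ->; rewrite orbT.
rewrite leq_add2l leq_mul2l; apply/orP; right.
rewrite mulSn !cntD; set c := cnt _ f.
have : c <= f by apply: cnt_leq.
have : cnt (fun i => ~~ T (f + i) && ((f + i < f) || T (f + i - f))) (k * f) <=
  cnt (fun i => ~~ T (f + i) && ((f <= f + i) && T (f + i - f))) (k * f).
  by apply: leq_cnt => i _; rewrite leq_addr ltnNge leq_addr.
lia.
Qed.

End Runs.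

(** * Hilbert cubes in dense sets *)

Fixpoint cube (B : pred nat) m es :=
  if es is e :: es' then cube B m es' && cube B (m + e) es' else B m.

Lemma sub_cube B C m es : (forall x, B x -> C x) -> cube B m es -> cube C m es.
Proof.
move=> sBC; elim: es m => [|e es IHes] m /=; first exact: sBC.
by case/andP=> /IHes-> /IHes->.
Qed.

Lemma cube_base B m es : cube B m es -> B m.
Proof. by elim: es => //= e es IHes /andP[/IHes]. Qed.

Lemma cube_shift B s m es : cube (fun i => B (s + i)) m es -> cube B (s + m) es.
Proof.
elim: es m => //= e es IHes m /andP[/IHes-> /IHes].
by rewrite addnA.
Qed.

Lemma cube_meet B e m es :
  cube (fun x => B x && B (x + e)) m es -> cube B m (e :: es).
Proof.
elim: es m => //= e' es IHes m /andP[/IHes/andP[-> H1] /IHes/andP[-> H2]].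
by rewrite /= H1 addnAC.
Qed.

(** Induction on the window: if a new last point is in [B], every earlier point of [B] is within
    distance [g] of it and so starts a counted pair. *)
Lemma cnt_le_gaps_short B g l : l <= g ->
  cnt B l <= 1 + \sum_(e < g) cnt (fun x => B x && B (x + e.+1)) l.
Proof.
elim: l => [|l IHl] lt_lg; first by rewrite /cnt big_ord0.
rewrite cntS; case Bl: (B l); last first.
  rewrite addn0; apply: leq_trans (IHl (ltnW lt_lg)) _.
  by rewrite leq_add2l; apply: leq_sum => e _; apply: leq_cntr.
rewrite addnC leq_add2l /cnt exchange_big /=.
rewrite big_ord_recr /=; apply: leq_trans (leq_addr _ _).
apply: leq_sum => -[x lt_xl] _ /=; case Bx: (B x) => //=.
have lt_e : l - x.+1 < g by lia.
rewrite (bigD1 (Ordinal lt_e)) //=.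
have -> : x + (l - x.+1).+1 = l by lia.
by rewrite Bl.
Qed.

(* Cut into blocks of length [g]: a block meeting [B] in [c] points has at least
   [c - 1] points followed by another one within distance [g]. *)
Lemma cnt_le_gaps B g h : 0 < g ->
  g * cnt B h <= h + g + g * \sum_(e < g) cnt (fun x => B x && B (x + e.+1)) h.
Proof.
move=> g_gt0; elim/ltn_ind: h B => h IHh B.
have [lt_hg | le_gh] := ltnP h g.
  by have := cnt_le_gaps_short B (ltnW lt_hg); nia.
have lt_h : h - g < h by lia.
have := IHh _ lt_h (fun i => B (g + i)); have := cnt_le_gaps_short B (leqnn g).
have eqh : h = g + (h - g) by lia.
have -> : \sum_(e < g) cnt (fun x => B x && B (x + e.+1)) h =
  \sum_(e < g) cnt (fun x => B x && B (x + e.+1)) g +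
  \sum_(e < g) cnt (fun x => B (g + x) && B (g + (x + e.+1))) (h - g).
  rewrite -big_split /=; apply: eq_bigr => e _.
  rewrite [in LHS]eqh cntD; congr addn; apply: eq_cnt => i _.
  by rewrite addnA.
have -> : cnt B h = cnt B g + cnt (fun i => B (g + i)) (h - g).
  by rewrite [in LHS]eqh cntD.
nia.
Qed.

(** Hilbert's cube lemma, by induction on [d]: for some positive [e <= 2 * q] the points [x] with
    [x] and [x + e] both in [B] have density at least [1 / (8 q^2)], and a cube among them doubles
    to one in [B]. *)
Lemma cube_exists d q : 0 < q -> exists h0, forall h, h0 <= h ->
  forall B, 0 < h <= q * cnt B h ->
  exists m es, [/\ size es = d, all (fun e => 0 < e <= h) es & cube B m es].
Proof.
elim: d q => [|d IHd] q q_gt0.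
  exists 0 => h _ B /andP[h_gt0 hB].
  have : ~~ [forall i : 'I_h, ~~ B i].
    apply: contraL hB => /forallP noB; rewrite -ltnNge /cnt big1 ?muln0 // => i _.
    by rewrite (negbTE (noB i)).
  by case/forallPn=> i /negPn Bi; exists i, [::].
have q'_gt0 : 0 < 8 * q * q by nia.
have [h0 IH] := IHd _ q'_gt0; exists (h0 + 4 * q).+1 => h le_h B /andP[h_gt0 hB].
have [/existsP[e he]|/existsPn noe] := boolP [exists e : 'I_(2 * q),
    h <= 8 * q * q * cnt (fun x => B x && B (x + e.+1)) h].
  have le_h0 : h0 <= h by lia.
  have [|m [es [sz_es all_es cube_es]]] := IH _ le_h0 (fun x => B x && B (x + e.+1)).
    by rewrite h_gt0.
  exists m, (e.+1 :: es); split; first by rewrite /= sz_es.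
    by rewrite /= all_es andbT; have := ltn_ord e; lia.
  exact: cube_meet.
have q2_gt0 : 0 < 2 * q by lia.
(* If no distance works, the pairs contribute at most [h / 2], so [2 h <= h + 2 q + h / 2], which
   fails because [h > 4 q]. *)
have := cnt_le_gaps B h q2_gt0.
have : 8 * q * q * \sum_(e < 2 * q) cnt (fun x => B x && B (x + e.+1)) h
    <= \sum_(e < 2 * q) h.
  by rewrite big_distrr /=; apply: leq_sum => e _; have := noe e; lia.
rewrite sum_nat_const card_ord; set S := \sum_(e < _) _ => leS leB.
exfalso.
have : 8 * q * S <= 2 * h by rewrite -(leq_pmul2l q_gt0); lia.
nia.
Qed.

(* [refl A m es] is the union of the point reflections [2 c - A], for [c] in the
   cube [m + {0, e_1} + ... + {0, e_d}]. *)
Fixpoint refl (A : pred nat) m es : pred nat :=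
  if es is e :: es' then fun x => refl A m es' x || refl A (m + e) es' x
  else fun x => (x <= 2 * m) && A (2 * m - x).

(** * Point reflections in the corners of a cube *)

Section Reflections.

Variables (A : pred nat) (u : nat).

Let A1 : pred nat := fun y => A y && (y < u).

(** Moving a centre by [e] moves the reflection by [2 * e]. Truncated subtraction does no harm: for
    [x < 2 * e] the mirror point exceeds [2 * m], so it is outside [A1]. *)
Lemma refl_shift e m es x : u <= m ->
  refl A1 (m + e) es x = (2 * e <= x) && refl A1 m es (x - 2 * e).
Proof.
elim: es m => [|e' es IHes] m le_um /=; last first.
  have le_um' : u <= m + e' by apply: leq_trans le_um (leq_addr _ _).
  by rewrite andb_orr -!IHes // addnAC.
rewrite /A1; have [le_ex|lt_xe] /= := leqP (2 * e) x.
  have -> : (x <= 2 * (m + e)) = (x - 2 * e <= 2 * m) by lia.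
  have -> : 2 * (m + e) - x = 2 * m - (x - 2 * e) by lia.
  by [].
by rewrite [_ < u]ltnNge [u <= _](_ : _ = true) ?andbF //; lia.
Qed.

(** If [x = 2 c - y] with [y < u <= c], then [y], [c], [x] would be a progression in [A]. *)
Lemma refl_disjoint m es x : apfree A -> u <= m -> cube A m es ->
  A x -> ~~ refl A1 m es x.
Proof.
move=> apA; elim: es m => [|e es IHes] m le_um /=; last first.
  case/andP=> /(IHes _ le_um) H1 /(IHes _ (leq_trans le_um (leq_addr _ _))) H2 Ax.
  by rewrite negb_or H1 ?H2.
move=> Am Ax; apply/negP=> /and3P[le_x Ay lt_yu].
have d_gt0 : 0 < m - (2 * m - x) by lia.
have := apA (2 * m - x) _ d_gt0; rewrite Ay /=.
rewrite (_ : 2 * m - x + (m - (2 * m - x)) = m) ?Am; last by lia.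
by rewrite (_ : 2 * m - x + _ = x) ?Ax; last by lia.
Qed.

Lemma leq_cnt_refl m es : u <= m < 2 * u ->
  cnt A u <= cnt (refl A1 m es) (4 * u).
Proof.
move=> /andP[le_um lt_mu].
apply: (@leq_trans (cnt (refl A1 m [::]) (4 * u))); last first.
  elim: es => //= e es IHes; apply: leq_trans IHes _.
  by apply: leq_cnt => x _ /= ->.
have lt_m4 : (2 * m).+1 <= 4 * u by lia.
apply: leq_trans (leq_cntr _ lt_m4).
rewrite [leqRHS](eq_cnt (B := fun x => A1 (2 * m - x))); last first.
  by move=> i; rewrite ltnS /= => ->.
rewrite cnt_rev; have le_u : u <= (2 * m).+1 by lia.
apply: leq_trans (leq_cntr _ le_u); apply: leq_cnt => i lt_iu Ai.
by rewrite /A1 Ai.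
Qed.

(* The reflected sets grow along the cube, so one of the [size es] steps must
   gain few points. *)
Lemma refl_stable h m es n : u <= m -> 0 < size es ->
    all (fun e => 0 < e <= h) es -> cube A m es ->
  exists e es', [/\ 0 < e <= h, cube A m es'
    & size es * cnt (fun x => ~~ refl A1 m es' x &&
        ((2 * e <= x) && refl A1 m es' (x - 2 * e))) n <= n].
Proof.
move=> le_um; set K := size es => K_gt0.
(* If each of the [K] steps gained more than [n / K] points, the last set would have more than [n]
   points below [n]. *)
suff main es1 : all (fun e => 0 < e <= h) es1 -> cube A m es1 ->
    (exists e es', [/\ 0 < e <= h, cube A m es'
    & K * cnt (fun x => ~~ refl A1 m es' x &&
        ((2 * e <= x) && refl A1 m es' (x - 2 * e))) n <= n])
    \/ size es1 * n.+1 <= K * cnt (refl A1 m es1) n.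
  move=> alle cubee; case: (main es) => // H; exfalso.
  by have := cnt_leq (refl A1 m es) n; rewrite -/K in H; nia.
elim: es1 => [|e es1 IHes] /=; first by right.
case/andP=> he alle /andP[c1 c2].
case: IHes => // [|IH]; first by left.
set D := cnt (fun x => ~~ refl A1 m es1 x &&
        ((2 * e <= x) && refl A1 m es1 (x - 2 * e))) n.
have [le_D|lt_D] := leqP (K * D) n; first by left; exists e, es1.
right; suff -> : cnt (fun x => refl A1 m es1 x || refl A1 (m + e) es1 x) n
  = cnt (refl A1 m es1) n + D by lia.
rewrite /cnt -big_split; apply: eq_bigr => i _ /=.
by rewrite refl_shift //; case: (refl A1 m es1 i); case: (_ && _).
Qed.

End Reflections.

(** * Density decrement and Roth's theorem *)

Lemma apfree_sub A s f : 0 < f -> apfree A -> apfree (fun i => A (s + i * f)).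
Proof.
move=> f_gt0 apA a d d_gt0; have df_gt0 : 0 < d * f by rewrite muln_gt0 d_gt0.
have -> : s + (a + d) * f = s + a * f + d * f by lia.
have -> : s + (a + 2 * d) * f = s + a * f + 2 * (d * f) by lia.
exact: apA.
Qed.

(** Cut into windows of length [L], whose translates are again progression-free; the incomplete last
    window costs at most [Q * L]. *)
Lemma cnt_subadd Q j L A n : 0 < L ->
    (forall B, apfree B -> Q * cnt B L <= j * L) -> apfree A ->
  Q * cnt A n <= j * n + Q * L.
Proof.
move=> L_gt0 bndL; elim/ltn_ind: n A => n IHn A apA.
have [lt_nL|le_Ln] := ltnP n L; first by have := cnt_leq A n; nia.
have lt_n : n - L < n by lia.
have apA' : apfree (fun i => A (L + i)).
  by move=> a d /(apA (L + a)); rewrite !addnA.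
have := IHn _ lt_n _ apA'; have := bndL _ apA.
have -> : cnt A n = cnt A L + cnt (fun i => A (L + i)) (n - L).
  by rewrite -cntD subnKC.
nia.
Qed.

(* Bounds of the form [Q * cnt A n <= j * n] discretize the extremal density as
   [j / Q], so that no limit is needed: [j] can only decrease. *)
Lemma density_decrement Q j L : 0 < Q -> 12 * Q <= j * (j - 5) -> 0 < L ->
    (forall A, apfree A -> Q * cnt A L <= j * L) ->
  exists2 n, 0 < n & forall A, apfree A -> Q * cnt A n <= j.-1 * n.
Proof.
move=> Q_gt0 leQ L_gt0 bndL.
(* With dimension [4 Q L], some step of the cube gains at most [4 u / (4 Q L)] points, so its runs
   cost at most [u]. *)
have [h0 cubeP] := cube_exists (4 * (Q * L)) Q_gt0.
(* [u] is a multiple of [h!], so [2 * e] divides [4 * u] whenever [0 < e <= h]; also [u >= 2 Q L h]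
   absorbs the additive errors. *)
pose h := h0.+1; pose v := h.-1`! * (2 * (Q * L) * h); pose u := v * h.
have QL_gt0 : 0 < Q * L by rewrite muln_gt0 Q_gt0.
have uE : u = h`! * (2 * (Q * L) * h) by rewrite /u /v mulnC mulnA -factS.
have v_gt0 : 0 < v by rewrite /v !muln_gt0 fact_gt0; lia.
have le_u : 2 * (Q * L) * h <= u.
  by rewrite uE; apply: leq_pmull; apply: fact_gt0.
have u_gt0 : 0 < u by rewrite muln_gt0 v_gt0.
have le_QLu : 2 * (Q * L) <= u by apply: leq_trans le_u; apply: leq_pmulr.
have j_gt5 : 5 < j by nia.
exists (4 * u); first by lia.
move=> A apA; rewrite leqNgt; apply/negP => denseA.
have apAs s : apfree (fun i => A (s + i)).
  by move=> a d /(apA (s + a)); rewrite !addnA.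
have bnd s n := cnt_subadd n L_gt0 bndL (apAs s).
have bnd0 n := cnt_subadd n L_gt0 bndL apA.
have le_ju : 6 * u <= j * u by rewrite leq_mul2r j_gt5 orbT.
rewrite -subn1 mulnBl mul1n in denseA.
(* No part of [[0, 4 u)] can much exceed density [j / Q], so each quarter must nearly reach it: the
   deficit [4 u] and an error of at most [u] give [j - 5]. *)
have dense_first : (j - 5) * u <= Q * cnt A u.
  rewrite mulnBl.
  have := bnd u (3 * u).
  have : cnt A (4 * u) = cnt A u + cnt (fun i => A (u + i)) (3 * u).
    by rewrite -cntD; congr cnt; lia.
  by move=> c4E bnd3; rewrite c4E in denseA; lia.
have dense_mid : v * h <= Q * cnt (fun i => A (u + i)) (v * h).
  have := bnd0 u; have := bnd (2 * u) (2 * u).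
  have : cnt A (4 * u) = cnt A u + cnt (fun i => A (u + i)) u
                         + cnt (fun i => A (2 * u + i)) (2 * u).
    by rewrite -cntD addnn -mul2n -cntD; congr cnt; lia.
  by move=> c4E bnd2 bnd1; rewrite -/u; rewrite c4E in denseA; lia.
have [b lt_bv dense_b] := cnt_pigeonhole v_gt0 dense_mid.
(* The cut at [h] keeps the base point of the cube in the second quarter. *)
pose B i := A (u + (b * h + i)) && (i < h).
have hB : 0 < h <= Q * cnt B h.
  by rewrite {1}/h /= (eq_cnt (B := fun i => A (u + (b * h + i)))) // => i lt_ih;
     rewrite /B lt_ih andbT.
have [m' [es [sz_es all_es cube_es]]] := cubeP h (leqnSn h0) _ hB.
pose m := u + b * h + m'.
have m_mid : u <= m < 2 * u.
  have /andP[_ lt_m] := cube_base cube_es.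
  have : b.+1 * h <= v * h by rewrite leq_mul2r lt_bv orbT.
  rewrite /m /u; lia.
have cubeA : cube A m es.
  apply: cube_shift; apply: sub_cube cube_es => x /andP[].
  by rewrite addnA.
have le_um : u <= m by case/andP: m_mid.
have sz_gt0 : 0 < size es by rewrite sz_es; lia.
have [e [es' [/andP[e_gt0 le_eh] cubeA' stab]]] :=
  refl_stable (4 * u) le_um sz_gt0 all_es cubeA.
set T := refl _ _ _ in stab.
have disj x : A x -> ~~ T x by apply: refl_disjoint.
have leT : cnt A u <= cnt T (4 * u) by apply: leq_cnt_refl.
have e2_gt0 : 0 < 2 * e by lia.
have [k kE] : exists k, 4 * u = k * (2 * e).
  have /dvdnP[c cE] : e %| h`! by apply: dvdn_fact; rewrite e_gt0.
  by exists (2 * c * (2 * (Q * L) * h)); rewrite uE cE; lia.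
have := cnt_runs_mod (Q := Q) (j := j) (K := Q * L) k disj
  (fun s l => cnt_subadd l L_gt0 bndL (apfree_sub s e2_gt0 apA)).
rewrite -kE; set D := cnt _ (4 * u) in stab *.
have := cntC T (4 * u); rewrite sz_es in stab.
set cT := cnt T _ in leT *; set cT' := cnt (predC T) _ => cTE.
have stab' : Q * L * D <= u by lia.
have le_jcT : 12 * u <= j * cT.
  rewrite -(leq_pmul2l Q_gt0); apply: (@leq_trans (j * ((j - 5) * u))).
    by rewrite [leqRHS]mulnA mulnA [Q * 12]mulnC leq_mul2r leQ orbT.
  rewrite [leqRHS]mulnCA leq_mul2l; apply/orP; right; apply: leq_trans dense_first _.
  by rewrite leq_mul2l leT orbT.
have le_QLe : Q * L * (2 * e) <= u.
  by apply: leq_trans le_u; rewrite mulnCA mulnA leq_mul2l le_eh orbT.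
(* The count is at most [4 j u - 12 u + 2 u], where [12 u] comes from [T] and [2 u] from the runs,
   against the assumed [4 j u - 4 u]. *)
move: denseA; rewrite mulnDr.
have -> : j * cT' = j * (4 * u) - j * cT by rewrite -cTE mulnDr; lia.
lia.
Qed.

(** Start from the trivial bound [j = Q], [L = 1] and decrement [j] until [j / Q <= 1 / (2 p)]; the
    other half of [1 / p] absorbs the boundary error. *)
Theorem roth p : 0 < p ->
  exists n0, forall n A, n0 <= n -> apfree A -> p * cnt A n <= n.
Proof.
(* While [2 p j > Q] one has [j > 28 p], hence [j - 5 >= 24 p] and [j (j - 5) >= 672 p^2 = 12 Q], as
   the decrement requires. *)
move=> p_gt0; pose Q := 56 * p * p; have Q_gt0 : 0 < Q by rewrite /Q; nia.
have sparse i L : 2 * p * i <= Q -> 0 < L ->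
    (forall A, apfree A -> Q * cnt A L <= i * L) ->
  exists n0, forall n A, n0 <= n -> apfree A -> p * cnt A n <= n.
  move=> le_iQ L_gt0 bndL; exists (2 * p * L) => n A le_n apA.
  have le_c := cnt_subadd n L_gt0 bndL apA.
  have Q2_gt0 : 0 < 2 * Q by rewrite muln_gt0 Q_gt0.
  rewrite -(leq_pmul2l Q2_gt0).
  have : 2 * p * (Q * cnt A n) <= 2 * p * (i * n + Q * L).
    by rewrite leq_mul2l le_c orbT.
  have : 2 * p * i * n <= Q * n by rewrite leq_mul2r le_iQ orbT.
  have : Q * (2 * p * L) <= Q * n by rewrite leq_mul2l le_n orbT.
  lia.
suff main : forall j L, 0 < L ->
      (forall A, apfree A -> Q * cnt A L <= j * L) ->
    exists n0, forall n A, n0 <= n -> apfree A -> p * cnt A n <= n.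
  have bnd1 A : apfree A -> Q * cnt A 1 <= Q * 1.
    by rewrite leq_mul2l cnt_leq orbT.
  exact: (main Q 1).
elim=> [|j IHj] L L_gt0 bndL.
  by apply: sparse bndL => //; rewrite muln0.
have [le_jQ|lt_Qj] := leqP (2 * p * j.+1) Q; first exact: sparse bndL.
have le_pj : 28 * p < j.+1 by rewrite /Q in lt_Qj; nia.
have le_Q : 12 * Q <= j.+1 * (j.+1 - 5).
  have le_p5 : 24 * p <= j.+1 - 5 by lia.
  apply: leq_trans (leq_mul (ltnW le_pj) le_p5); rewrite /Q; lia.
have [n n_gt0 bndn] := density_decrement Q_gt0 le_Q L_gt0 bndL.
exact: IHj bndn.
Qed.


(** * Binary digits of powers of 3 *)

(* Give each [S] the weight [t ^ (m - #|S|)]: the total weight is [(1 + t) ^ m],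
   and sparse sets are heavy. *)
Lemma card_sparse_sets p t m (F : {set {set 'I_m}}) : 0 < p -> 0 < t ->
    (forall S, S \in F -> p * #|S| <= m) ->
  #|F| * t ^ m <= t ^ (m %/ p) * t.+1 ^ m.
Proof.
move=> p_gt0 t_gt0 sparse.
have sumS : \sum_(S : {set 'I_m}) t ^ (m - #|S|) = t.+1 ^ m.
  (* Expand [(1 + t) ^ m] over subsets: factor [1] on [S], factor [t] off it. *)
  have := bigA_distr 1 addn (fun _ : 'I_m => 1) (fun=> t).
  rewrite /= prod_nat_const card_ord add1n => ->; apply: eq_bigr => S _.
  rewrite (bigID (mem S)) /= big1 ?mul1n; last by move=> i ->.
  rewrite (eq_bigr (fun=> t)); last by move=> i /negbTE->.
  rewrite prod_nat_const; congr (_ ^ _).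
  by rewrite -[X in X - _](card_ord m) -(cardC (mem S)) addKn.
rewrite -sumS big_distrr /= -sum_nat_const.
rewrite [leqRHS](bigID (mem F)) /=; apply: leq_trans (leq_addr _ _).
apply: leq_sum => S FS; rewrite -expnD leq_pexp2l // addnC -leq_subLR.
rewrite subKn; last by rewrite -[leqRHS]card_ord max_card.
by rewrite leq_divRL // mulnC sparse.
Qed.

Lemma expn3_mod8 n : exists y, 3 ^ n = 8 * y + (if odd n then 3 else 1).
Proof.
elim: n => [|n [y IHn]]; first by exists 0.
rewrite expnS IHn /=; case: (odd n) => /=; last by exists (3 * y); lia.
by exists (3 * y + 1); lia.
Qed.

(** Factor [3 ^ (2 k) - 1 = (3 ^ k - 1) (3 ^ k + 1)]. For even [k] the second factor is twice an odd
    number, so induction applies; for odd [k] the product is 8 times an odd number. Odd exponents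
    fail mod 4. *)
Lemma dvdn_expn3_sub1 m n : 2 ^ m.+2 %| 3 ^ n - 1 -> 2 ^ m %| n.
Proof.
elim: m n => [|m IHm] n; first by rewrite dvd1n.
have [n_odd|] := boolP (odd n) => [dvd3n|].
  have : 4 %| 3 ^ n - 1 by apply: dvdn_trans dvd3n; apply: (@dvdn_exp2l 2 2).
  by have [y ->] := expn3_mod8 n; rewrite n_odd; lia.
move/even_halfK => nE; set k := n./2 in nE.
rewrite -nE -muln2 expnM; have [y] := expn3_mod8 k.
case: ifP => k_odd kE.
  have -> : (3 ^ k) ^ 2 - 1 = 2 ^ 3 * ((4 * y + 1) * (2 * y + 1)).
    by rewrite kE -mulnn; nia.
  rewrite -[m.+3]add3n expnD dvdn_pmul2l //.
  case: m {IHm} => [|m] dvd_odd; first by rewrite expn1 dvdn_mull.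
  have : 2 %| (4 * y + 1) * (2 * y + 1).
    by apply: dvdn_trans dvd_odd; rewrite expnS dvdn_mulr.
  have y_odd : odd ((4 * y + 1) * (2 * y + 1)) by rewrite oddM !addn1 /= !oddM.
  by rewrite dvdn2 y_odd.
have -> : (3 ^ k) ^ 2 - 1 = 2 * ((3 ^ k - 1) * (4 * y + 1)).
  by rewrite kE -mulnn; nia.
rewrite [2 ^ m.+3]expnS dvdn_pmul2l // Gauss_dvdl.
  by rewrite [2 ^ m.+1]expnS mulnC => /IHm; rewrite dvdn_pmul2r.
by rewrite coprime_pexpl // coprime2n addn1 /= oddM.
Qed.

Lemma expn3_mod_inj m a b : a < 2 ^ m -> b < 2 ^ m ->
  3 ^ a = 3 ^ b %[mod 2 ^ m.+2] -> a = b.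
Proof.
wlog le_ab : a b / a <= b => [main|] lta ltb.
  case/orP: (leq_total a b) => [/main|le_ba /esym]; first exact.
  by move/(main _ _ le_ba) => ->.
move/esym/eqP; rewrite eqn_mod_dvd ?leq_pexp2l //.
rewrite -{1}(subnKC le_ab) expnD -[X in _ - X]muln1 -mulnBr Gauss_dvdr; last first.
  by rewrite coprime_pexpl // coprime2n oddX orbT.
move/dvdn_expn3_sub1; case: (posnP (b - a)) => [|ba_gt0 /(dvdn_leq ba_gt0)]; lia.
Qed.

Lemma natpowE a k : Nat.pow a k = a ^ k.
Proof. by elim: k => //= k ->; rewrite expnS. Qed.

Lemma modn_modulo x y : 0 < y -> x %% y = Nat.modulo x y.
Proof.
move=> y_gt0; rewrite {1}(Nat.div_mod_eq x y) multE plusE mulnC modnMDl.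
by rewrite modn_small //; apply/ltP/Nat.mod_upper_bound; lia.
Qed.

Lemma modn_testbit n x y :
    (forall i, i < n -> Nat.testbit x i = Nat.testbit y i) ->
  x = y %[mod 2 ^ n].
Proof.
move=> eqxy.
rewrite !modn_modulo ?expn_gt0 // -natpowE; apply: Nat.bits_inj => i.
have [/ltP lt_in|/leP le_ni] := ltnP i n.
  by rewrite !Nat.mod_pow2_bits_low // eqxy //; apply/ltP.
by rewrite !Nat.mod_pow2_bits_high.
Qed.

Definition digits m k : {set 'I_m} := [set i : 'I_m | omega i k].

Lemma digits_inj m a b : a < 2 ^ m -> b < 2 ^ m ->
  digits m.+2 a = digits m.+2 b -> a = b.
Proof.
move=> lta ltb /setP eq_ab; apply: expn3_mod_inj lta ltb _.
apply: modn_testbit => i lt_im; have := eq_ab (Ordinal lt_im).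
by rewrite !inE /omega /= !natpowE.
Qed.

Lemma apfree_W k : W k -> apfree (fun i => omega i k).
Proof.
move=> Wk a d d_gt0; apply/negP => /and3P[A1 A2 A3]; apply: Wk.
by exists a, d; split; [apply/leP | split; [|split]].
Qed.

Lemma size_W_sparse p t : 0 < p -> 0 < t ->
  exists n0, forall m (s : seq nat), n0 <= m -> uniq s ->
    (forall k, k \in s -> k < 2 ^ m /\ W k) ->
  size s * t ^ m.+2 <= t ^ (m.+2 %/ p) * t.+1 ^ m.+2.
Proof.
move=> p_gt0 t_gt0; have [n0 rothp] := roth p_gt0; exists n0 => m s le_m us sW.
have inj : {in s &, injective (digits m.+2)}.
  by move=> a b /sW[lta _] /sW[ltb _]; apply: digits_inj.
have <- : #|[set S in map (digits m.+2) s]| = size s.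
  rewrite cardsE -(size_map (digits m.+2)); apply/card_uniqP.
  by rewrite map_inj_in_uniq.
apply: card_sparse_sets => // S.
rewrite inE => /mapP[k /sW[_ /apfree_W apk] ->].
have := rothp m.+2 _ _ apk; rewrite /digits cardsE -sum1_card big_mkcond /=.
by rewrite /cnt; apply; lia.
Qed.

Local Open Scope R_scope.

(** Transfers [size_W_sparse] to standard-library lists and reals. *)
Lemma length_W_sparse p t : p <> 0%N -> t <> 0%N ->
  exists n0, forall m (l : list nat), (n0 <= m)%coq_nat -> List.NoDup l ->
    (forall k, List.In k l -> (k < Nat.pow 2 m)%coq_nat /\ W k) ->
  exists2 q, (Nat.mul q p <= S (S m))%coq_nat &
    INR (List.length l) * INR t ^ S (S m) <= INR t ^ q * INR (S t) ^ S (S m).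
Proof.
move=> /eqP; rewrite -lt0n => p_gt0 /eqP; rewrite -lt0n => t_gt0.
have [n0 bnd] := size_W_sparse p_gt0 t_gt0.
have InP k (l : seq nat) : reflect (List.In k l) (k \in l).
  elim: l => [|x l IHl] /=; first by right.
  rewrite in_cons eq_sym; apply: (iffP orP) => -[/eqP|/IHl]; auto.
exists n0 => m l /leP le_m ul lW; exists (m.+2 %/ p)%N.
  by apply/leP; apply: leq_divM.
rewrite -!pow_INR -!mult_INR !natpowE; apply/le_INR/leP/bnd => //.
  elim: l ul {lW} => //= k l IHl /NoDup_cons_iff[/InP-> /IHl].
  exact.
by move=> k /InP/lW[/ltP]; rewrite natpowE.
Qed.

End APFree.

(** * Choice of parameters and final estimate *)

Open Scope R_scope.

Lemma pow_as_exp (x : R) (n : nat) : 0 < x -> x ^ n = exp (INR n * ln x).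
Proof. intros Hx. now rewrite <- (Rpower_pow n x Hx). Qed.

Lemma ln_le (x y : R) : 0 < x -> x <= y -> ln x <= ln y.
Proof.
intros Hx [Hlt|<-]; [left; now apply ln_increasing|apply Rle_refl].
Qed.

Lemma exp_le (x y : R) : x <= y -> exp x <= exp y.
Proof. intros [Hlt|<-]; [left; now apply exp_increasing|apply Rle_refl]. Qed.

(** Take [1 / t <= c / 2], so that [(1 + 1 / t) ^ M <= exp (c M / 2)], then [ln t / p <= c / 2], so
    that [t ^ q <= exp (c M / 2)]. *)
Lemma exists_sparseness (c : R) : 0 < c ->
  exists t p : nat, t <> 0%nat /\ p <> 0%nat /\
    forall M q : nat, (q * p <= M)%nat ->
      INR t ^ q * INR (S t) ^ M <= exp (c * INR M) * INR t ^ M.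
Proof.
intros Hc.
destruct (INR_unbounded (2 / c)) as [t Ht].
assert (Hc2 : 0 < 2 / c) by (apply Rdiv_lt_0_compat; lra).
assert (Ht0 : 0 < INR t) by lra.
assert (Htn : t <> 0%nat) by (intros ->; simpl in Ht0; lra).
destruct (INR_unbounded (2 / c * ln (INR t))) as [p Hp].
assert (Hln : 0 <= ln (INR t)).
{ rewrite <- ln_1. apply ln_le; [lra|]. apply (le_INR 1). lia. }
assert (Hp0 : 0 < INR p).
{ apply Rle_lt_trans with (2 := Hp). apply Rmult_le_pos; lra. }
exists t, p. split; [exact Htn|]. split; [intros ->; simpl in Hp0; lra|].
intros M q Hq.
assert (HSt : INR (S t) ^ M <= exp (INR M * (c / 2)) * INR t ^ M).
{ replace (INR M * (c / 2)) with (INR M * ln (exp (c / 2))) by now rewrite ln_exp.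
  rewrite <- pow_as_exp by apply exp_pos. rewrite <- Rpow_mult_distr.
  apply pow_incr. split; [apply pos_INR|]. rewrite S_INR.
  apply Rle_trans with ((1 + c / 2) * INR t).
  - assert (2 / c * (c / 2) <= INR t * (c / 2)) by (apply Rmult_le_compat_r; lra).
    replace (2 / c * (c / 2)) with 1 in H by (field; lra). lra.
  - apply Rmult_le_compat_r; [lra|]. apply exp_ineq1_le. }
assert (Htq : INR t ^ q <= exp (INR M * (c / 2))).
{ rewrite pow_as_exp by assumption.
  assert (Hle : INR q * ln (INR t) <= INR M * (c / 2)).
  { apply le_INR in Hq. rewrite mult_INR in Hq.
    apply Rle_trans with (INR q * (INR p * (c / 2))).
    - apply Rmult_le_compat_l; [apply pos_INR|].
      replace (ln (INR t)) with (2 / c * ln (INR t) * (c / 2)) by (field; lra).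
      apply Rmult_le_compat_r; lra.
    - rewrite <- Rmult_assoc. apply Rmult_le_compat_r; lra. }
  now apply exp_le. }
replace (c * INR M) with (INR M * (c / 2) + INR M * (c / 2)) by field.
rewrite exp_plus, Rmult_assoc.
apply Rmult_le_compat; try assumption; apply pow_le; [lra|apply pos_INR].
Qed.

(* #(W ∩ [1,N]) = O_eps(N^eps): the cardinality is expressed as a bound on the
   length of every duplicate-free list of elements of W ∩ [1,N]. *)
Theorem theorem6p2 :
  forall eps : R, 0 < eps ->
  exists C : R, 0 < C /\
    forall (N : nat), (1 <= N)%nat ->
    forall l : list nat, NoDup l ->
      (forall k, In k l -> (1 <= k <= N)%nat /\ W k) ->
      INR (length l) <= C * Rpower (INR N) eps.
Proof.
intros eps Heps.
assert (Hln2 : 0 < ln 2) by (rewrite <- ln_1; apply ln_increasing; lra).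
(* The rate [eps * ln 2] turns [exp] of it times [log2 N] into at most [N ^ eps]. *)
destruct (exists_sparseness (eps * ln 2)) as (t & p & Ht & Hp & Hbnd).
{ now apply Rmult_lt_0_compat. }
destruct (APFree.length_W_sparse Hp Ht) as [n0 Hsparse].
exists (exp (eps * ln 2 * INR (n0 + 3))). split; [apply exp_pos|].
intros N HN l Hnd Hl.
destruct (Nat.log2_spec N HN) as [Hlog_le Hlog_lt].
(* This gives both [n0 <= m] and [N < 2 ^ m]; as [m + 2 = n0 + 3 + log2 N], the constant carries
   [n0 + 3]. *)
set (m := (n0 + S (Nat.log2 N))%nat).
destruct (Hsparse m l) as [q Hq Hlen]; [lia|assumption| |].
{ intros k Hk. destruct (Hl k Hk) as [[_ HkN] HkW]. split; [|exact HkW].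
  assert (2 ^ S (Nat.log2 N) <= 2 ^ m)%nat by (apply Nat.pow_le_mono_r; lia).
  change (k < 2 ^ m)%nat. lia. }
pose proof (Rle_trans _ _ _ Hlen (Hbnd (S (S m)) q Hq)) as H.
apply Rmult_le_reg_r in H; [|apply pow_lt, lt_0_INR; lia].
apply (Rle_trans _ _ _ H). unfold Rpower. rewrite <- exp_plus.
assert (HlogR : INR (Nat.log2 N) * ln 2 <= ln (INR N)).
{ rewrite <- ln_exp at 1. rewrite <- pow_as_exp by lra.
  apply ln_le; [apply pow_lt; lra|].
  rewrite <- (pow_INR 2). now apply le_INR. }
assert (Hle : eps * ln 2 * INR (S (S m))
              <= eps * ln 2 * INR (n0 + 3) + eps * ln (INR N)).
{ replace (S (S m)) with (n0 + 3 + Nat.log2 N)%nat by (unfold m; lia).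
  rewrite (plus_INR (n0 + 3)), Rmult_plus_distr_l.
  apply Rplus_le_compat_l. rewrite Rmult_assoc.
  apply Rmult_le_compat_l; [lra|]. now rewrite Rmult_comm. }
now apply exp_le.
Qed.
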